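(* Let $\Lambda$ be a ring, $S$ a nonempty set, and for each $p\in S$ let $d_p$ be a function assigning to every $\Lambda$-module an element of $\{0,1,2,\dots\}\cup\{\infty\}$. Let $f\colon S\to\{0,1,2,\dots\}\cup\{\infty\}$ be a function and $U$ a subset of $S$. Then: (1) For every $\Lambda$-module $N$, $\widetilde{S}^{f}(N)=\inf\{d_{p}(N)\mid p\in Y^{f}(N)\}$. (2) If $d_{p}$ satisfies $(\widetilde{d1})$ (resp. (d3); resp. all of (d1), (d2), (d3)) for every $p\in S$, then the function $T^{U}$ also satisfies $(\widetilde{d1})$ (resp. (d3); resp. all of (d1), (d2), (d3)). (3) If $d_{p}$ satisfies $(\widetilde{d1})$ (resp. (d3)) for every $p\in S$, then the function $\widetilde{S}^{f}$ also satisfies $(\widetilde{d1})$ (resp. (d3)).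
   Context: Infimum of the empty set is $\infty$. Conditions on a function $d$ from $\Lambda$-modules to $\{0,1,\dots\}\cup\{\infty\}$, required for every short exact sequence $0\to K\to L\to N\to0$ of $\Lambda$-modules: $(\widetilde{d1})$ if $d(L)>d(K)$, then $d(K)\ge d(N)+1$; (d1) if $d(L)>d(K)$, then $d(K)=d(N)+1$; (d2) if $d(L)>d(N)$, then $d(K)=d(N)+1$; (d3) if $d(L)<d(N)$, then $d(K)\le d(L)$. For a $\Lambda$-module $N$: $N$ satisfies $\widetilde{S}^f_i$ ($i$ an integer) if $d_p(N)\ge\inf\{i,f(p)\}$ for all $p\in S$; $\widetilde{S}^f(N)=\sup\{i\mid N\text{ satisfies }\widetilde{S}^f_i\}$; $Y^f(N)=\{p\in S\mid d_p(N)<f(p)\}$; $T^U(N)=\inf\{d_p(N)\mid p\in U\}$. *)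

(* Defs.v *)
From mathcomp Require Export all_boot all_order all_algebra.
From mathcomp Require Export boolp classical_sets constructive_ereal.

Set Implicit Arguments.
Unset Strict Implicit.
Unset Printing Implicit Defensive.

Import Order.TTheory GRing.Theory Num.Theory.

Local Open Scope classical_set_scope.
Local Open Scope ereal_scope.

(* Values in {0, 1, 2, ...} U {oo} are the nonnegative elements of \bar int,
   so that they can be compared with integers; the functions on modules take
   values in \bar int, and nonnegativity is stated separately.               *)
Definition enat_valued (T : Type) (d : T -> \bar int) : Prop :=
  forall x, 0 <= d x.

(* inf of the empty set is oo; sup of the empty set is -oo. *)
Definition einf (A : set (\bar int)) : \bar int := infimum +oo A.
Definition esup (A : set (\bar int)) : \bar int := supremum -oo A.

Section Conditions.
Variable Lambda : pzRingType.
Implicit Types (K L N : lmodType Lambda) (d : lmodType Lambda -> \bar int).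

Definition short_exact K L N (u : {linear K -> L}) (v : {linear L -> N}) : Prop :=
  [/\ injective u, range u = v @^-1` [set 0%R] & range v = setT].

Definition d1_tilde d : Prop :=
  forall K L N (u : {linear K -> L}) (v : {linear L -> N}),
    short_exact u v -> d K < d L -> d N + 1 <= d K.

Definition d1 d : Prop :=
  forall K L N (u : {linear K -> L}) (v : {linear L -> N}),
    short_exact u v -> d K < d L -> d K = d N + 1.

Definition d2 d : Prop :=
  forall K L N (u : {linear K -> L}) (v : {linear L -> N}),
    short_exact u v -> d N < d L -> d K = d N + 1.

Definition d3 d : Prop :=
  forall K L N (u : {linear K -> L}) (v : {linear L -> N}),
    short_exact u v -> d L < d N -> d K <= d L.

Variables (S : Type) (d : S -> lmodType Lambda -> \bar int).

Definition S_tilde_cond (f : S -> \bar int) (i : int) N : Prop :=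
  forall p, Order.min i%:E (f p) <= d p N.

Definition S_tilde (f : S -> \bar int) N : \bar int :=
  esup [set i%:E | i in [set i : int | S_tilde_cond f i N]].

Definition Y (f : S -> \bar int) N : set S := [set p | d p N < f p].

Definition T (U : set S) N : \bar int := einf [set d p N | p in U].

End Conditions.

(* Main.v *)
Require Import Defs.

Set Implicit Arguments.
Unset Strict Implicit.
Unset Printing Implicit Defensive.

Import Order.TTheory GRing.Theory Num.Theory.

(** Every nonempty set of values in {0, 1, ...} U {oo} has a least element, so
    the infima defining T^U and (through part (1)) S~^f are attained whenever
    they are exceeded by something.  Part (1) holds because min(i, f p) <= d_p N
    only constrains i when p is in Y^f N.  For part (3), let S~(M) = d_p M with
    p in Y^f M.  If S~(M) < S~(M'), then d_p M < d_p M': either p is in Y^f M',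
    and d_p M' >= S~(M') > d_p M, or d_p M' >= f p > d_p M.  The condition
    on d_p then applies, and its conclusion keeps the relevant value below f p,
    hence p in the relevant Y^f.  Finally T^U is S~^f for f = oo on U and f = 0
    off U, so that (3) contains the first two claims of (2). *)

Local Open Scope classical_set_scope.
Local Open Scope ereal_scope.

Lemma lee_add1 (x y : \bar int) : x < y -> x + 1 <= y.
Proof.
case: x y => [x||] [y||] // xy; rewrite ?leey//.
by rewrite -EFinD lee_fin lezD1 -lte_fin.
Qed.

Lemma esup_lub (A : set (\bar int)) (m : \bar int) :
  supremums A m -> esup A = m.
Proof.
move=> Am; rewrite /esup /supremum; case: eqP => [A0|_].
  by case: Am => _ /(_ -oo); rewrite A0 leeNy_eq => /(_ _)/eqP->.
case: xgetP => [x _ Ax|/(_ m)//].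
exact: is_subset1_supremums Ax Am.
Qed.

Lemma esup_EFin_le (m : \bar int) :
  esup [set i%:E | i in [set i : int | i%:E <= m]] = m.
Proof.
apply: esup_lub; split=> [_ [i im <-] //|y yub].
case: m yub => [m||] yub; last exact: leNye.
  by apply: yub; exists m => /=.
case: y yub => [y||] // yub.
- have /yub : [set i%:E | i in [set i : int | i%:E <= +oo]] (y + 1)%R%:E.
    by exists (y + 1)%R => //=; exact: leey.
  by rewrite lee_fin lezD1 ltxx.
- have /yub : [set i%:E | i in [set i : int | i%:E <= +oo]] 0%R%:E.
    by exists 0%R => //=; exact: leey.
  by [].
Qed.

Lemma ge0_ex_least (A : set (\bar int)) :
  (forall x, A x -> 0 <= x) -> A !=set0 -> exists2 m, A m & lbound A m.
Proof.
move=> A0 [a Aa].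
have [[n An]|noA] := pselect (exists n : nat, A n%:Z%:E); last first.
  exists a => // x Ax; case: x Ax (A0 _ Ax) => [[n|n]||] // Ax _.
    by case: noA; exists n.
  exact: leey.
have exA : exists n : nat, `[< A n%:Z%:E >] by exists n; apply/asboolP.
case: (ex_minnP exA) => m /asboolP Am mmin; exists m%:Z%:E => // x Ax.
case: x Ax (A0 _ Ax) => [[k|k]||] // Ax _.
by rewrite lee_fin lez_nat; apply/mmin/asboolP.
Qed.

Lemma einf_least (A : set (\bar int)) :
  (forall x, A x -> 0 <= x) -> A !=set0 -> A (einf A) /\ lbound A (einf A).
Proof.
move=> A0 An0; have [m Am lbm] := ge0_ex_least A0 An0.
suff -> : einf A = m by [].
have infm : infimums A m by split=> // y; exact.
rewrite /einf /infimum; case: eqP => [A00|_].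
  by move: Am; rewrite A00.
case: xgetP => [x _ Ax|/(_ m)//].
exact: is_subset1_infimums Ax infm.
Qed.

Lemma ge_einf (A : set (\bar int)) (x : \bar int) :
  (forall x, A x -> 0 <= x) -> A x -> einf A <= x.
Proof. by move=> A0 Ax; apply: (einf_least A0 _).2 => //; exists x. Qed.

Lemma einf_mem (A : set (\bar int)) (y : \bar int) :
  (forall x, A x -> 0 <= x) -> einf A < y -> A (einf A).
Proof.
move=> A0 Ay; apply: (einf_least A0 _).1; apply/set0P/eqP => A00.
by move: Ay; rewrite A00 /einf /infimum eqxx ltNge leey.
Qed.

Lemma le_einf (A : set (\bar int)) (y : \bar int) :
  (forall x, A x -> 0 <= x) -> lbound A y -> y <= einf A.
Proof.
move=> A0 lby; rewrite leNgt; apply/negP => Ay.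
by move: (lby _ (einf_mem A0 Ay)); rewrite leNgt Ay.
Qed.

Section Infima.
Variables (Lambda : pzRingType) (S : Type) (d : S -> lmodType Lambda -> \bar int).
Hypothesis d_ge0 : forall p, enat_valued (d p).
Implicit Types (f : S -> \bar int) (U : set S) (K L M N : lmodType Lambda).

Let vals_ge0 U N (x : \bar int) : [set d p N | p in U] x -> 0 <= x.
Proof. by move=> [p _ <-]; exact: d_ge0. Qed.

Lemma T_ge0 U : enat_valued (T d U).
Proof. by move=> N; apply: le_einf => [|_ [p _ <-]]; [exact: vals_ge0|exact: d_ge0]. Qed.

Lemma T_le U p N : U p -> T d U N <= d p N.
Proof. by move=> Up; apply: ge_einf; [exact: vals_ge0|exists p]. Qed.

Lemma T_attained U N (y : \bar int) :
  T d U N < y -> exists2 p, U p & d p N = T d U N.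
Proof. exact: einf_mem (@vals_ge0 _ _). Qed.

Lemma S_tildeE f N : S_tilde d f N = T d (Y d f N) N.
Proof.
rewrite -[RHS]esup_EFin_le /S_tilde; congr esup; congr image.
apply/seteqP; split=> i /=.
  move=> iS; apply: le_einf; first exact: vals_ge0.
  move=> _ [p pY <-]; move: (iS p).
  by rewrite ge_min (leNgt (f p)) pY orbF.
move=> iT p; rewrite ge_min; have [//|dpf] := leP (f p) (d p N).
  by rewrite orbT.
by rewrite (le_trans iT)// T_le.
Qed.

Lemma S_tilde_ge0 f : enat_valued (S_tilde d f).
Proof. by move=> N; rewrite S_tildeE; exact: T_ge0. Qed.

Lemma S_tilde_le f p N : d p N < f p -> S_tilde d f N <= d p N.
Proof. by move=> pY; rewrite S_tildeE T_le. Qed.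

Lemma S_tilde_lt f M N : S_tilde d f M < S_tilde d f N ->
  exists p, [/\ d p M = S_tilde d f M, d p M < f p & d p M < d p N].
Proof.
move=> MN; have [p pY pM] : exists2 p, Y d f M p & d p M = S_tilde d f M.
  by move: MN; rewrite [in X in X -> _]S_tildeE [in X in _ -> X]S_tildeE => /T_attained.
exists p; split=> //.
have [|] := ltP (d p N) (f p); last exact: lt_le_trans.
by move=> /S_tilde_le; apply: lt_le_trans; rewrite pM.
Qed.

Lemma S_tilde_d1_tilde f :
  (forall p, d1_tilde (d p)) -> d1_tilde (S_tilde d f).
Proof.
move=> d1t K L N u v uv /S_tilde_lt[p [<- pK /(d1t _ _ _ _ _ _ uv) NK]].
apply: (le_trans _ NK); rewrite leeD2r// S_tilde_le//.
by apply: le_lt_trans pK; apply: le_trans NK; rewrite leeDl.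
Qed.

Lemma S_tilde_d3 f : (forall p, d3 (d p)) -> d3 (S_tilde d f).
Proof.
move=> hd3 K L N u v uv /S_tilde_lt[p [<- pL /(hd3 _ _ _ _ _ _ uv) KL]].
by apply: (le_trans _ KL); rewrite S_tilde_le// (le_lt_trans KL).
Qed.

Lemma T_S_tilde U :
  T d U = S_tilde d (fun p => if p \in U then +oo else 0).
Proof.
apply/funext => N; rewrite S_tildeE; apply/eqP; rewrite eq_le; apply/andP; split.
  apply: le_einf => [|_ [p pY <-]]; first exact: vals_ge0.
  move: pY; rewrite /Y/=; case: ifPn => [/set_mem Up _|_]; first exact: T_le.
  by rewrite ltNge d_ge0.
apply: le_einf => [|_ [p Up <-]]; first exact: vals_ge0.
have [->|dfin] := eqVneq (d p N) +oo; first exact: leey.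
by apply: T_le; rewrite /Y/= mem_set// ltey.
Qed.

Lemma T_lt U M N : T d U M < T d U N ->
  exists p, [/\ U p, d p M = T d U M & d p M < d p N].
Proof.
move=> MN; have [p Up pM] := T_attained MN.
by exists p; rewrite pM; split=> //; exact: lt_le_trans (T_le _ Up).
Qed.

Lemma T_d2_le U K L N (u : {linear K -> L}) (v : {linear L -> N}) :
  (forall p, d2 (d p)) -> short_exact u v ->
  T d U N < T d U L -> T d U K <= T d U N + 1.
Proof.
move=> hd2 uv /T_lt[p [Up <- /(hd2 _ _ _ _ _ _ uv) <-]].
exact: T_le.
Qed.

Lemma T_d1 U :
  (forall p, d1 (d p)) -> (forall p, d2 (d p)) -> d1 (T d U).
Proof.
move=> hd1 hd2 K L N u v uv KL; apply/eqP.
have NK : T d U N + 1 <= T d U K.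
  have [p [Up <- /(hd1 _ _ _ _ _ _ uv) ->]] := T_lt KL.
  by rewrite leeD2r// T_le.
rewrite eq_le NK andbT; apply: (T_d2_le hd2 uv).
by apply: le_lt_trans KL; apply: le_trans NK; rewrite leeDl.
Qed.

Lemma T_d2 U :
  (forall p, d1 (d p)) -> (forall p, d2 (d p)) -> d2 (T d U).
Proof.
move=> hd1 hd2 K L N u v uv NL.
have [KL|LK] := ltP (T d U K) (T d U L); first exact: T_d1 uv KL.
apply/eqP; rewrite eq_le (T_d2_le hd2 uv NL)/=.
exact: le_trans (lee_add1 NL) LK.
Qed.

End Infima.

Local Close Scope ereal_scope.

Theorem proposition2p2 (Lambda : pzRingType) (S : Type) (hS : inhabited S)
    (d : S -> lmodType Lambda -> \bar int)
    (hd : forall p : S, enat_valued (d p))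
    (f : S -> \bar int) (hf : enat_valued f) (U : set S) :
  (* (1) *)
  (forall N : lmodType Lambda,
     S_tilde d f N = einf [set d p N | p in Y d f N]) /\
  (* (2) *)
  [/\ enat_valued (T d U),
      (forall p : S, d1_tilde (d p)) -> d1_tilde (T d U),
      (forall p : S, d3 (d p)) -> d3 (T d U) &
      (forall p : S, [/\ d1 (d p), d2 (d p) & d3 (d p)]) ->
      [/\ d1 (T d U), d2 (T d U) & d3 (T d U)] ] /\
  (* (3) *)
  [/\ enat_valued (S_tilde d f),
      (forall p : S, d1_tilde (d p)) -> d1_tilde (S_tilde d f) &
      (forall p : S, d3 (d p)) -> d3 (S_tilde d f) ].
Proof.
have Td3 : (forall p : S, d3 (d p)) -> d3 (T d U).
  by rewrite T_S_tilde//; exact: S_tilde_d3.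
split; first by move=> N; exact: S_tildeE.
split; split.
- exact: T_ge0.
- by rewrite T_S_tilde//; exact: S_tilde_d1_tilde.
- exact: Td3.
- move=> h; have hd1 p : d1 (d p) by case: (h p).
  have hd2 p : d2 (d p) by case: (h p).
  split; [exact: T_d1 | exact: T_d2 | by apply: Td3 => p; case: (h p)].
- exact: S_tilde_ge0.
- exact: S_tilde_d1_tilde.
- exact: S_tilde_d3.
Qed.
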